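(* Let $G=(A\cup B,E)$ be an instance of the strongly stable matching problem and let $\mathcal{X}$ be the set of $\sim$-equivalence classes of strongly stable matchings of $G$. The map $S\mapsto\bigvee S$ is a bijection from the set of nonempty closed subsets of $I(\mathcal{M}_G)$ onto $\mathcal{X}$.
   Context: An instance of the strongly stable matching problem is a finite bipartite graph $G=(A\cup B,E)$ (vertices of $A$ are ''men'', of $B$ ''women'') in which every vertex $v$ has a preference list: its neighbours are partitioned into disjoint ties (possibly singletons) which are linearly ordered. For neighbours $x,y$ of $v$ write $x\succ_v y$ if $x$ lies in a strictly earlier tie than $y$, $x=_v y$ if in the same tie, $x\succeq_v y$ if either. A matching is a set of pairwise vertex-disjoint edges; $M(v)$ is the partner of $v$. An edge $e\in E\setminus M$ blocks $M$ if its endpoints can be labelled $x,y$ with ($x$ unmatched or $y\succ_x M(x)$) and ($y$ unmatched or $x\succeq_y M(y)$); $M$ is strongly stable if no edge blocks it. All strongly stable matchings match the same vertices. For strongly stable $M,N$: $M\succeq N$ ($M$ dominates $N$) if $M(m)\succeq_m N(m)$ for every matched man $m$; $M\sim N$ if $M(m)=_m N(m)$ for every matched man $m$; $[M]$ is the $\sim$-class of $M$, and $[M]\succeq[N]$ iff $M\succeq N$. The operation $M\vee N$ is the matching containing, for each matched man $m$, the edge $(m,N(m))$ if $M(m)\succ_m N(m)$ and $(m,M(m))$ otherwise; it is strongly stable, and $[M]\vee[N]:=[M\vee N]$ is well defined. For a nonempty finite set $S$ of classes, $\bigvee S$ is the iterated $\vee$ of its elements. For an edge $(a,b)$ ($a\in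 A$) contained in some strongly stable matching, let $N$ be a strongly stable matching containing $(a,b)$ that dominates every strongly stable matching containing $(a,b)$ (such $N$ exists); define $M(a,b):=[N]$. A class is irreducible if it equals $M(a,b)$ for some such edge; $I(\mathcal{M}_G)$ is the set of irreducible classes, partially ordered by dominance. A subset $S\subseteq I(\mathcal{M}_G)$ is closed if whenever $T\in S$ and $T'\in I(\mathcal{M}_G)$ dominates $T$, then $T'\in S$.
   Formalization: The graph G is assumed to have at least one edge; if E is empty, the empty matching gives one class in X while I(M_G) is empty and has no nonempty closed subset, so the claim as stated fails. *)

(* Defs.v *)
From mathcomp Require Import all_boot.

Set Implicit Arguments.
Unset Strict Implicit.
Unset Printing Implicit Defensive.

Section PreferenceLists.
Variable T : finType.
Implicit Type p : seq {set T}.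

(* A preference list over the neighbourhood N is the sequence of its ties, *)
(* from the most to the least preferred.                                   *)
Definition pref_list (N : {set T}) p : bool :=
  uniq p && partition [set t in p] N.

Definition tie_index p (x : T) : nat := find (fun t : {set T} => x \in t) p.

(* The three comparisons are meaningful for x and y occurring in p only; *)
(* they are only used for neighbours of the vertex owning p.             *)
Definition succ_pref p (x y : T) : bool := tie_index p x < tie_index p y.
Definition eq_pref p (x y : T) : bool := tie_index p x == tie_index p y.
Definition succeq_pref p (x y : T) : bool := succ_pref p x y || eq_pref p x y.

End PreferenceLists.

Record ssm_instance (A B : finType) := SSMInstance {
  edges : {set A * B};
  mpref : A -> seq {set B};
  wpref : B -> seq {set A};
  mprefP : forall a, pref_list [set b | (a, b) \in edges] (mpref a);
  wprefP : forall b, pref_list [set a | (a, b) \in edges] (wpref b)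
}.

Section StronglyStable.
Variables (A B : finType) (G : ssm_instance A B).
Implicit Types (M N : {set A * B}) (e f : A * B) (a : A) (b : B).

Definition is_matching M : bool :=
  (M \subset edges G) &&
  [forall e in M, forall f in M, (e != f) ==> (e.1 != f.1) && (e.2 != f.2)].

Definition mpartner M a : option B := [pick b | (a, b) \in M].
Definition wpartner M b : option A := [pick a | (a, b) \in M].

Definition man_gains M a b : bool :=
  if mpartner M a is Some b' then succ_pref (mpref G a) b b' else true.
Definition man_accepts M a b : bool :=
  if mpartner M a is Some b' then succeq_pref (mpref G a) b b' else true.
Definition woman_gains M b a : bool :=
  if wpartner M b is Some a' then succ_pref (wpref G b) a a' else true.
Definition woman_accepts M b a : bool :=
  if wpartner M b is Some a' then succeq_pref (wpref G b) a a' else true.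

Definition blocks M e : bool :=
  (e \in edges G :\: M) &&
  (man_gains M e.1 e.2 && woman_accepts M e.2 e.1
   || woman_gains M e.2 e.1 && man_accepts M e.1 e.2).

Definition strongly_stable M : bool :=
  is_matching M && [forall e, ~~ blocks M e].

(* All strongly stable matchings match the same men, so for strongly stable *)
(* M and N the men constrained by [dominates] and [sim] are exactly the     *)
(* matched ones.                                                            *)
Definition dominates M N : bool :=
  [forall a, if (mpartner M a, mpartner N a) is (Some b, Some c)
             then succeq_pref (mpref G a) b c else true].

Definition sim M N : bool :=
  [forall a, if (mpartner M a, mpartner N a) is (Some b, Some c)
             then eq_pref (mpref G a) b c else true].

Definition ssm_class M : {set {set A * B}} :=
  [set N | strongly_stable N & sim M N].

Definition ssm_classes : {set {set {set A * B}}} :=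
  equivalence_partition sim [set M | strongly_stable M].

Definition vee M N : {set A * B} :=
  [set e | if (mpartner M e.1, mpartner N e.1) is (Some b, Some c)
           then e.2 == (if succ_pref (mpref G e.1) b c then c else b)
           else false].

Implicit Types X Y : {set {set A * B}}.

Definition class_dominates X Y : bool :=
  [exists M in X, exists N in Y, dominates M N].

(* [M] \/ [N] := [M \/ N], without choosing representatives: as this is *)
(* well defined, all the classes in the union coincide.                 *)
Definition class_vee X Y : {set {set A * B}} :=
  \bigcup_(M in X) \bigcup_(N in Y) ssm_class (vee M N).

(* The value at set0 is a dummy: only nonempty sets of classes have a join. *)
Definition bigvee (S : {set {set {set A * B}}}) : {set {set A * B}} :=
  if enum S is X :: s then foldl class_vee X s else set0.

Definition stable_edge e : bool := [exists M, strongly_stable M && (e \in M)].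

Definition dominant_with e N : bool :=
  [&& strongly_stable N, e \in N &
      [forall N', strongly_stable N' && (e \in N') ==> dominates N N']].

(* A dominant N exists for every stable edge, so that the default value is *)
(* never reached; any two such N are equivalent.                           *)
Definition edge_class e : {set {set A * B}} :=
  if [pick N | dominant_with e N] is Some N then ssm_class N else set0.

Definition irreducibles : {set {set {set A * B}}} :=
  [set edge_class e | e in stable_edge].

Definition closed_irr (S : {set {set {set A * B}}}) : bool :=
  (S \subset irreducibles) &&
  [forall T in S, forall T' in irreducibles,
     class_dominates T' T ==> (T' \in S)].

Definition nonempty_closed : {set {set {set {set A * B}}}} :=
  [set S | (S != set0) && closed_irr S].

End StronglyStable.

(* Main.v *)
(* Rank the partner of every agent by the index of its tie, and being unmatched
   after all the ties. For strongly stable M and N, M maps the men P preferring M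
   to N into the women Q preferring N to M, and N maps Q into P; by counting, M
   and N both restrict to bijections between P and Q. So M and N match the same
   men, and exchanging M for N on P and Q gives again a strongly stable matching;
   in this way the man-wise worst and the man-wise best choices from M and N are
   both strongly stable. If T = M(a,b) dominates the join of a closed set S, then
   some element of S gives to a a partner no better than b; taking man-wise best
   choices with T shows that T dominates this element, hence lies in S. So S is
   the set of all irreducibles dominating its join, and conversely the class of M
   is the join of the irreducibles dominating it, since M(m,M(m)) is one of them
   for every matched m. *)
Require Import Defs.
From mathcomp Require Import all_boot.

Set Implicit Arguments.
Unset Strict Implicit.
Unset Printing Implicit Defensive.

(** * Preferences as numerical ranks *)

Lemma tie_index_lt (T : finType) (N : {set T}) (p : seq {set T}) (x : T) :
  pref_list N p -> x \in N -> tie_index p x < size p.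
Proof.
case/andP=> _ /and3P[/eqP <- _ _] /bigcupP[t]; rewrite inE => tp xt.
by rewrite -has_find; apply/hasP; exists t.
Qed.

Lemma succ_prefE (T : finType) (p : seq {set T}) (x y : T) :
  succ_pref p x y = (tie_index p x < tie_index p y).
Proof. by []. Qed.

Lemma succeq_prefE (T : finType) (p : seq {set T}) (x y : T) :
  succeq_pref p x y = (tie_index p x <= tie_index p y).
Proof. by rewrite /succeq_pref /succ_pref /eq_pref orbC -leq_eqVlt. Qed.

Section Ranks.
Variables (A B : finType) (G : ssm_instance A B).
Implicit Types (M N K : {set A * B}) (e f : A * B) (a : A) (b : B).

(* Being unmatched is ranked after all the ties. *)
Definition mrank M a : nat :=
  if mpartner M a is Some b then tie_index (mpref G a) b else size (mpref G a).
Definition wrank M b : nat :=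
  if wpartner M b is Some a then tie_index (wpref G b) a else size (wpref G b).

Lemma mtie_lt a b : (a, b) \in edges G -> tie_index (mpref G a) b < size (mpref G a).
Proof. by move=> ab; apply: tie_index_lt (mprefP G a) _; rewrite inE. Qed.

Lemma wtie_lt a b : (a, b) \in edges G -> tie_index (wpref G b) a < size (wpref G b).
Proof. by move=> ab; apply: tie_index_lt (wprefP G b) _; rewrite inE. Qed.

Section Matching.
Variable M : {set A * B}.
Hypothesis matchM : is_matching G M.

Lemma matching_edge e : e \in M -> e \in edges G.
Proof. by case/andP: matchM => /subsetP sM _; apply: sM. Qed.

Lemma matching_fst a b c : (a, b) \in M -> (a, c) \in M -> b = c.
Proof.
case/andP: matchM => _ /'forall_in_forall_inP H Mb Mc.
apply: contraTeq isT => bc; move: (H _ Mb _ Mc) => /implyP /=.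
by rewrite xpair_eqE eqxx bc /= => /(_ isT).
Qed.

Lemma matching_snd a c b : (a, b) \in M -> (c, b) \in M -> a = c.
Proof.
case/andP: matchM => _ /'forall_in_forall_inP H Ma Mc.
apply: contraTeq isT => ac; move: (H _ Ma _ Mc) => /implyP /=.
by rewrite xpair_eqE eqxx (negbTE ac) /= => /(_ isT).
Qed.

Lemma mpartner_eq a b : (a, b) \in M -> mpartner M a = Some b.
Proof.
rewrite /mpartner; case: pickP => [c Mc Mb|/(_ b) -> //].
by rewrite (matching_fst Mc Mb).
Qed.

Lemma wpartner_eq a b : (a, b) \in M -> wpartner M b = Some a.
Proof.
rewrite /wpartner; case: pickP => [c Mc Ma|/(_ a) -> //].
by rewrite (matching_snd Mc Ma).
Qed.

Lemma mrank_eq a b : (a, b) \in M -> mrank M a = tie_index (mpref G a) b.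
Proof. by move=> /mpartner_eq; rewrite /mrank => ->. Qed.

Lemma wrank_eq a b : (a, b) \in M -> wrank M b = tie_index (wpref G b) a.
Proof. by move=> /wpartner_eq; rewrite /wrank => ->. Qed.

Lemma mrank_le a : mrank M a <= size (mpref G a).
Proof.
rewrite /mrank /mpartner; case: pickP => // b /matching_edge ab.
exact: ltnW (mtie_lt ab).
Qed.

Lemma wrank_le b : wrank M b <= size (wpref G b).
Proof.
rewrite /wrank /wpartner; case: pickP => // a /matching_edge ab.
exact: ltnW (wtie_lt ab).
Qed.

Lemma mrank_lt a : (mrank M a < size (mpref G a)) = (mpartner M a != None).
Proof.
rewrite /mrank /mpartner; case: pickP => [b /matching_edge/mtie_lt -> //|_].
by rewrite ltnn eqxx.
Qed.

End Matching.

Lemma mpartner_mem M a b : mpartner M a = Some b -> (a, b) \in M.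
Proof. by rewrite /mpartner; case: pickP => // c ac [<-]. Qed.

Lemma mrank_matched M a : mrank M a < size (mpref G a) -> exists b, (a, b) \in M.
Proof.
rewrite /mrank /mpartner; case: pickP => [b ab _|_]; first by exists b.
by rewrite ltnn.
Qed.

Lemma wrank_matched M b : wrank M b < size (wpref G b) -> exists a, (a, b) \in M.
Proof.
rewrite /wrank /wpartner; case: pickP => [a ab _|_]; first by exists a.
by rewrite ltnn.
Qed.

(** For an edge, the tie indices lie below the rank of an unmatched agent, so the same inequalities
    cover matched and unmatched endpoints. *)
Definition rank_blocks M e : bool :=
  let: (a, b) := e in
  let i := tie_index (mpref G a) b in let j := tie_index (wpref G b) a in
  (i < mrank M a) && (j <= wrank M b) || (j < wrank M b) && (i <= mrank M a).

Lemma blocksE M e :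
  blocks G M e = (e \in edges G :\: M) && rank_blocks M e.
Proof.
rewrite /blocks; case: e => a b; case: (boolP (_ \in _)) => //= /setDP[ab _].
have [lta ltb] := (mtie_lt ab, wtie_lt ab).
rewrite /man_gains /woman_accepts /woman_gains /man_accepts /mrank /wrank.
by case: mpartner => [c|]; case: wpartner => [d|];
  rewrite ?succeq_prefE ?succ_prefE ?lta ?ltb ?(ltnW lta) ?(ltnW ltb).
Qed.

Lemma strongly_stableP M :
  reflect (is_matching G M /\
           forall e, e \in edges G -> e \notin M -> ~~ rank_blocks M e)
          (strongly_stable G M).
Proof.
apply: (iffP andP) => -[matchM H]; split=> //.
  move=> e eE eM; move/forallP: H => /(_ e).
  by rewrite blocksE inE eM eE.
apply/forallP=> e; rewrite blocksE inE; apply/negP => /andP[/andP[eM eE]].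
exact/negP/H.
Qed.

(** * Exchanging one matching for another on part of the agents *)

Definition splice (P : {set A}) M N : {set A * B} :=
  [set e | e \in (if e.1 \in P then N else M)].

Section Splice.
Variables (P : {set A}) (Q : {set B}) (M N : {set A * B}).
Hypothesis saturated : forall a b, (a, b) \in M :|: N -> (a \in P) = (b \in Q).

Lemma saturatedl a b : (a, b) \in M -> (a \in P) = (b \in Q).
Proof. by move=> ab; apply: saturated; rewrite inE ab. Qed.

Lemma saturatedr a b : (a, b) \in N -> (a \in P) = (b \in Q).
Proof. by move=> ab; apply: saturated; rewrite inE ab orbT. Qed.

Lemma mem_splice a b :
  ((a, b) \in splice P M N) = ((a, b) \in (if a \in P then N else M)).
Proof. by rewrite inE. Qed.

(** No edge of [M] or [N] leaves [P] and [Q], so choosing the matching by the man or by the woman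
    gives the same result; this puts the two sides on an equal footing. *)
Lemma mem_splice_snd a b :
  ((a, b) \in splice P M N) = ((a, b) \in (if b \in Q then N else M)).
Proof.
rewrite mem_splice; have [/saturatedl -> //|abM] := boolP ((a, b) \in M).
have [/saturatedr -> //|abN] := boolP ((a, b) \in N).
by case: ifP; case: ifP => _ _; rewrite ?(negbTE abM) ?(negbTE abN).
Qed.

Lemma mrank_splice a :
  mrank (splice P M N) a = if a \in P then mrank N a else mrank M a.
Proof.
rewrite /mrank; have -> : mpartner (splice P M N) a =
  mpartner (if a \in P then N else M) a.
  by apply: eq_pick => b; rewrite mem_splice.
by case: (a \in P).
Qed.

Lemma wrank_splice b :
  wrank (splice P M N) b = if b \in Q then wrank N b else wrank M b.
Proof.
rewrite /wrank; have -> : wpartner (splice P M N) b =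
  wpartner (if b \in Q then N else M) b.
  by apply: eq_pick => a; rewrite mem_splice_snd.
by case: (b \in Q).
Qed.

Lemma splice_matching :
  is_matching G M -> is_matching G N -> is_matching G (splice P M N).
Proof.
move=> mM mN; apply/andP; split.
  apply/subsetP=> -[a b]; rewrite mem_splice.
  by case: ifP => _; apply: matching_edge.
apply/'forall_in_forall_inP=> -[a b] ab [c d] cd; apply/implyP => /= ne.
apply/andP; split; apply: contraNneq ne => /= eq.
  rewrite -eq in cd *; move: ab cd; rewrite !mem_splice.
  by case: ifP => _ ab cd; rewrite (@matching_fst _ _ _ _ _ ab cd).
rewrite -eq in cd *; move: ab cd; rewrite !mem_splice_snd.
by case: ifP => _ ab cd; rewrite (@matching_snd _ _ _ _ _ ab cd).
Qed.

(* By hypothesis, an edge joining [P] to the complement of [Q], or [Q] to the  *)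
(* complement of [P], has an endpoint weakly preferring its partner in the     *)
(* splice to its other partner. If it blocks the splice, it thus also blocks   *)
(* the matching from which its other endpoint takes its partner.               *)
Lemma splice_stable :
  strongly_stable G M -> strongly_stable G N ->
  (forall a b, a \in P -> b \notin Q ->
     mrank N a <= mrank M a \/ wrank M b <= wrank N b) ->
  (forall a b, a \notin P -> b \in Q ->
     mrank M a <= mrank N a \/ wrank N b <= wrank M b) ->
  strongly_stable G (splice P M N).
Proof.
move=> /strongly_stableP[mM sM] /strongly_stableP[mN sN] PnQ nPQ.
apply/strongly_stableP; split=> [|[a b] abE]; first exact: splice_matching.
have mono (i j x y x' y' : nat) : x <= x' -> y <= y' ->
    (i < x) && (j <= y) || (j < y) && (i <= x) ->
    (i < x') && (j <= y') || (j < y') && (i <= x').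
  move=> xx yy /orP[] /andP[h1 h2]; apply/orP; [left|right].
    by rewrite (leq_trans h1 xx) (leq_trans h2 yy).
  by rewrite (leq_trans h1 yy) (leq_trans h2 xx).
have nM : (a \in P) != (b \in Q) -> (a, b) \notin M.
  by apply: contraNN => /saturatedl/eqP.
have nN : (a \in P) != (b \in Q) -> (a, b) \notin N.
  by apply: contraNN => /saturatedr/eqP.
rewrite mem_splice /rank_blocks mrank_splice wrank_splice => abS.
have [aP|aP] := boolP (a \in P); have [bQ|bQ] := boolP (b \in Q);
  move: nM nN abS; rewrite ?aP ?bQ ?(negbTE aP) ?(negbTE bQ) => nM nN abS.
- exact: (sN _ abE).
- have [le|le] := PnQ _ _ aP bQ.
    exact: contra (mono _ _ _ _ _ _ le (leqnn _)) (sM _ abE (nM isT)).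
  exact: contra (mono _ _ _ _ _ _ (leqnn _) le) (sN _ abE (nN isT)).
- have [le|le] := nPQ _ _ aP bQ.
    exact: contra (mono _ _ _ _ _ _ le (leqnn _)) (sN _ abE (nN isT)).
  exact: contra (mono _ _ _ _ _ _ (leqnn _) le) (sM _ abE (nM isT)).
- exact: (sM _ abE).
Qed.

End Splice.

(** * Counting the agents with opposite preferences; matched men *)

Definition men_preferring M N : {set A} := [set a | mrank M a < mrank N a].
Definition women_preferring M N : {set B} := [set b | wrank M b < wrank N b].

(** Otherwise [b] likes [a] at least as much as her situation in [N], and since [a] gains strictly
    the pair blocks [N]. *)
Lemma man_prefers_woman_rejects M N a b :
  strongly_stable G M -> strongly_stable G N -> (a, b) \in M ->
  a \in men_preferring M N -> b \in women_preferring N M.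
Proof.
move=> /strongly_stableP[mM _] /strongly_stableP[mN sN] abM.
rewrite !inE => lt; have abN : (a, b) \notin N.
  by apply: contraTN lt => abN; rewrite (mrank_eq mM abM) (mrank_eq mN abN) ltnn.
apply: contraR (sN _ (matching_edge mM abM) abN); rewrite -leqNgt => le.
by rewrite /rank_blocks -(mrank_eq mM abM) -(wrank_eq mM abM) lt le.
Qed.

Lemma woman_prefers_man_rejects M N a b :
  strongly_stable G M -> strongly_stable G N -> (a, b) \in M ->
  b \in women_preferring M N -> a \in men_preferring N M.
Proof.
move=> /strongly_stableP[mM _] /strongly_stableP[mN sN] abM.
rewrite !inE => lt; have abN : (a, b) \notin N.
  by apply: contraTN lt => abN; rewrite (wrank_eq mM abM) (wrank_eq mN abN) ltnn.
apply: contraR (sN _ (matching_edge mM abM) abN); rewrite -leqNgt => le.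
by rewrite /rank_blocks -(mrank_eq mM abM) -(wrank_eq mM abM) lt le orbT.
Qed.

(** The cardinalities satisfy [P <= MP <= MQ <= Q <= NQ <= NP <= P]. This cycle forces equality
    throughout, so both inclusions of edge sets are equalities and [N] covers [P]. *)
Lemma preferring_saturated M N :
  strongly_stable G M -> strongly_stable G N ->
  (forall a b, (a, b) \in M :|: N ->
     (a \in men_preferring M N) = (b \in women_preferring N M)) /\
  (forall a, a \in men_preferring M N -> exists b, (a, b) \in N).
Proof.
move=> sM sN; have [[mM _] [mN _]] := (strongly_stableP _ sM, strongly_stableP _ sN).
set P := men_preferring M N; set Q := women_preferring N M.
pose MP := [set e in M | e.1 \in P]; pose MQ := [set e in M | e.2 \in Q].
pose NP := [set e in N | e.1 \in P]; pose NQ := [set e in N | e.2 \in Q].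
have MPQ : MP \subset MQ.
  apply/subsetP=> -[a b]; rewrite !inE /= => /andP[ab aP].
  by rewrite ab; have:= man_prefers_woman_rejects sM sN ab; rewrite !inE; apply.
have NQP : NQ \subset NP.
  apply/subsetP=> -[a b]; rewrite !inE /= => /andP[ab bQ].
  by rewrite ab; have:= woman_prefers_man_rejects sN sM ab; rewrite !inE; apply.
have leP : #|P| <= #|MP|.
  apply: leq_trans (leq_imset_card fst _); apply/subset_leq_card/subsetP => a aP.
  (* A strict preference for [M] forces a partner in [M]: the rank in [N] is at most the number of
     ties. *)
  have [|b ab] := @mrank_matched M a.
    by move: aP; rewrite inE => /leq_trans; apply; apply: mrank_le.
  by apply/imsetP; exists (a, b) => //; rewrite inE ab.
have leMQ : #|MQ| <= #|Q|.
  rewrite -(@card_in_imset _ _ snd MQ) => [|[a b] [c d]].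
    by apply/subset_leq_card/subsetP => _ /imsetP[e + ->]; rewrite inE => /andP[].
  rewrite !inE /= => /andP[ab _] /andP[cd _] eq; rewrite -eq in cd *.
  by rewrite (matching_snd mM ab cd).
have leQ : #|Q| <= #|NQ|.
  apply: leq_trans (leq_imset_card snd _); apply/subset_leq_card/subsetP => b bQ.
  have [|a ab] := @wrank_matched N b.
    by move: bQ; rewrite inE => /leq_trans; apply; apply: wrank_le.
  by apply/imsetP; exists (a, b) => //; rewrite inE ab.
have subNP : fst @: NP \subset P.
  by apply/subsetP => _ /imsetP[e + ->]; rewrite inE => /andP[].
have cardNP : #|fst @: NP| = #|NP|.
  apply: card_in_imset => -[a b] [c d].
  rewrite !inE /= => /andP[ab _] /andP[cd _] eq; rewrite -eq in cd *.
  by rewrite (matching_fst mN ab cd).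
have leNP : #|NP| <= #|P| by rewrite -cardNP subset_leq_card.
have leN := subset_leq_card NQP; have leM := subset_leq_card MPQ.
have eqM : MP = MQ.
  apply/eqP; rewrite eqEcard MPQ.
  exact: leq_trans leMQ (leq_trans leQ (leq_trans leN (leq_trans leNP leP))).
have eqN : NQ = NP.
  apply/eqP; rewrite eqEcard NQP.
  exact: leq_trans leNP (leq_trans leP (leq_trans leM (leq_trans leMQ leQ))).
have eqP : fst @: NP = P.
  apply/eqP; rewrite eqEcard subNP cardNP.
  exact: leq_trans leP (leq_trans leM (leq_trans leMQ (leq_trans leQ leN))).
split=> [a b|a]; last first.
  rewrite -{1}eqP => /imsetP[[c b]]; rewrite inE => /andP[cb _] /= ->.
  by exists b.
case/setUP => ab.
  by have /setP/(_ (a, b)) := eqM; rewrite !(inE, in_set) /= ab.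
by have /setP/(_ (a, b)) := eqN; rewrite !(inE, in_set) /= ab.
Qed.

(** A man matched by [M] only would strictly prefer [M], but [N] matches all such men. *)
Lemma matched_lt M N a : strongly_stable G M -> strongly_stable G N ->
  mrank M a < size (mpref G a) -> mrank N a < size (mpref G a).
Proof.
move=> sM sN lt; have [[mM _] [mN _]] := (strongly_stableP _ sM, strongly_stableP _ sN).
rewrite ltn_neqAle mrank_le // andbT; apply/negP=> /eqP eq.
have [_ /(_ a)] := preferring_saturated sM sN; rewrite inE eq => /(_ lt)[b ab].
by move: (mtie_lt (matching_edge mN ab)); rewrite -(mrank_eq mN ab) eq ltnn.
Qed.

Lemma mpartner_None M N a : strongly_stable G M -> strongly_stable G N ->
  (mpartner M a == None) = (mpartner N a == None).
Proof.
move=> sM sN; have [[mM _] [mN _]] := (strongly_stableP _ sM, strongly_stableP _ sN).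
apply: negb_inj; rewrite -!mrank_lt //.
by apply/idP/idP; apply: matched_lt.
Qed.

(** The men skipped by [dominates] are unmatched in both matchings, hence have equal ranks there. *)
Lemma dominatesP M N : strongly_stable G M -> strongly_stable G N ->
  reflect (forall a, mrank M a <= mrank N a) (dominates G M N).
Proof.
move=> sM sN; apply: (iffP forallP) => H a; have := H a;
  have := mpartner_None a sM sN; rewrite /mrank;
  case: mpartner => [b|]; case: mpartner => [c|] //=; by rewrite succeq_prefE.
Qed.

Lemma simP M N : strongly_stable G M -> strongly_stable G N ->
  reflect (mrank M =1 mrank N) (sim G M N).
Proof.
move=> sM sN; apply: (iffP forallP) => H a; have := H a;
  have := mpartner_None a sM sN; rewrite /mrank;
  case: mpartner => [b|]; case: mpartner => [c|] //= _.
  by move/eqP.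
by move=> eqbc; apply/eqP.
Qed.

(** * Join and meet of two strongly stable matchings *)

Lemma vee_splice M N : strongly_stable G M -> strongly_stable G N ->
  vee G M N = splice (men_preferring M N) M N.
Proof.
move=> sM sN; have [[mM _] [mN _]] := (strongly_stableP _ sM, strongly_stableP _ sN).
have memE K a b : is_matching G K -> ((a, b) \in K) = (mpartner K a == Some b).
  by move=> mK; apply/idP/eqP => [/(mpartner_eq mK)|/mpartner_mem].
apply/setP=> -[a b]; rewrite mem_splice !inE /=.
have -> : ((a, b) \in if mrank M a < mrank N a then N else M) =
  if mrank M a < mrank N a then mpartner N a == Some b else mpartner M a == Some b.
  by case: ifP => _; rewrite memE.
have := mpartner_None a sM sN; rewrite /mrank /succ_pref.
case: mpartner => [c|]; case: mpartner => [d|] //= _.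
  by case: ifP => _; rewrite eq_sym.
by rewrite ltnn.
Qed.

(** Men get their worse choice, so the women supply the condition on crossing edges: each of them
    receives the better of her two situations. *)
Lemma vee_stable M N : strongly_stable G M -> strongly_stable G N ->
  strongly_stable G (vee G M N).
Proof.
move=> sM sN; rewrite vee_splice //.
have [sat _] := preferring_saturated sM sN.
apply: (splice_stable sat) => // a b.
  by rewrite !inE -leqNgt => _ le; right.
by rewrite !inE => _ /ltnW le; right.
Qed.

Lemma mrank_vee M N a : strongly_stable G M -> strongly_stable G N ->
  mrank (vee G M N) a = maxn (mrank M a) (mrank N a).
Proof. by move=> sM sN; rewrite vee_splice // mrank_splice inE. Qed.

(** The man-wise best choice, dual to [vee]. Ties go to [M], so an edge of [M] survives unless its
    man strictly prefers [N]. *)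
Definition wedge M N : {set A * B} := splice (men_preferring N M) M N.

Lemma wedge_stable M N : strongly_stable G M -> strongly_stable G N ->
  strongly_stable G (wedge M N).
Proof.
move=> sM sN; have [sat _] := preferring_saturated sN sM.
rewrite setUC in sat; apply: (splice_stable sat) => // a b.
  by rewrite !inE => /ltnW le _; left.
by rewrite !inE -leqNgt => le _; left.
Qed.

Lemma mrank_wedge M N a : mrank (wedge M N) a = minn (mrank M a) (mrank N a).
Proof. by rewrite mrank_splice inE minnC. Qed.

Lemma mem_wedge M N a b :
  (a, b) \in M -> mrank M a <= mrank N a -> (a, b) \in wedge M N.
Proof. by move=> ab; rewrite mem_splice inE ltnNge => ->. Qed.

(** * Classes and iterated joins *)

Lemma ssm_class_eq M N : strongly_stable G M -> strongly_stable G N ->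
  ssm_class G M = ssm_class G N <-> mrank M =1 mrank N.
Proof.
move=> sM sN; split=> [/setP/(_ N)|eqMN].
  by rewrite !inE sN /= => E; apply/simP => //; rewrite E; apply/simP.
apply/setP=> K; rewrite !inE; have [sK|//] := boolP (strongly_stable G K).
by apply/simP/simP => // E a; rewrite -E eqMN.
Qed.

Lemma mem_ssm_class M N : strongly_stable G M ->
  N \in ssm_class G M <-> strongly_stable G N /\ mrank M =1 mrank N.
Proof.
by move=> sM; rewrite inE; split=> [/andP[sN /simP E]|[sN E]];
   [split=> //; apply: E | rewrite sN; apply/simP].
Qed.

Lemma class_dominatesP M N : strongly_stable G M -> strongly_stable G N ->
  reflect (forall a, mrank M a <= mrank N a)
          (class_dominates G (ssm_class G M) (ssm_class G N)).
Proof.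
move=> sM sN; apply: (iffP exists_inP) => [[M' + /exists_inP[N']]|H].
  move=> /(mem_ssm_class _ sM)[sM' EM] /(mem_ssm_class _ sN)[sN' EN].
  by move/dominatesP => H a; rewrite EM EN; apply: H.
exists M; first exact/mem_ssm_class.
by apply/exists_inP; exists N; [apply/mem_ssm_class | apply/dominatesP].
Qed.

Lemma class_vee_class M N : strongly_stable G M -> strongly_stable G N ->
  class_vee G (ssm_class G M) (ssm_class G N) = ssm_class G (vee G M N).
Proof.
move=> sM sN; apply/setP=> K; apply/bigcupP/idP => [[M' + /bigcupP[N']]|KV].
  move=> /(mem_ssm_class _ sM)[sM' EM] /(mem_ssm_class _ sN)[sN' EN].
  have [_ -> //] := ssm_class_eq (vee_stable sM' sN') (vee_stable sM sN).
  by move=> a; rewrite !mrank_vee // EM EN.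
exists M; first exact/mem_ssm_class.
by apply/bigcupP; exists N => //; apply/mem_ssm_class.
Qed.

(** Joins act on ranks as maxima, and the maximum of a nonempty finite family is attained; the
    member attaining it may depend on the man. *)
Lemma bigvee_class (S : {set {set {set A * B}}}) : S != set0 ->
  (forall X, X \in S -> exists2 M, strongly_stable G M & X = ssm_class G M) ->
  exists K, [/\ strongly_stable G K, bigvee G S = ssm_class G K,
    forall N a, strongly_stable G N -> ssm_class G N \in S -> mrank N a <= mrank K a
  & forall a, exists N, [/\ strongly_stable G N, ssm_class G N \in S
                          & mrank N a = mrank K a]].
Proof.
move=> S0 SC; rewrite /bigvee.
have mS X : (X \in S) = (X \in enum S) by rewrite mem_enum.
case E: (enum S) => [|X s].
  case/set0Pn: S0 => X; by rewrite mS E.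
have [] : exists K, [/\ strongly_stable G K, foldl (class_vee G) X s = ssm_class G K,
    forall N a, strongly_stable G N -> ssm_class G N \in X :: s -> mrank N a <= mrank K a
  & forall a, exists N, [/\ strongly_stable G N, ssm_class G N \in X :: s
                          & mrank N a = mrank K a]]; last first.
  move=> K [sK EK H1 H2]; exists K; split=> // [N a sN|a].
    by rewrite mS E; apply: H1.
  by have [N [sN NS eN]] := H2 a; exists N; split=> //; rewrite mS E.
have {}SC Y : Y \in X :: s -> exists2 M, strongly_stable G M & Y = ssm_class G M.
  by move=> Ys; apply: SC; rewrite mS E.
(* Induction from the right, as [foldl] joins the last class last. *)
elim/last_ind: s SC {E} => [|s Y IHs] SC.
  have [|M sM EX] := SC X; first exact: mem_head.
  exists M; split=> //= [N a sN|a].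
    by rewrite inE EX => /eqP/ssm_class_eq -> //.
  by exists M; rewrite EX mem_head.
have [|K [sK EK H1 H2]] := IHs.
  by move=> Z Zs; apply: SC; rewrite -rcons_cons mem_rcons inE Zs orbT.
have [|M sM EY] := SC Y.
  by rewrite -rcons_cons mem_rcons mem_head.
exists (vee G K M); split.
- exact: vee_stable.
- by rewrite foldl_rcons EK EY class_vee_class.
- move=> N a sN; rewrite -rcons_cons mem_rcons inE mrank_vee // leq_max.
  case/orP=> [|/H1 -> //]; rewrite EY => /eqP/ssm_class_eq -> //.
  by rewrite leqnn orbT.
move=> a; rewrite mrank_vee //; case: (leqP (mrank K a) (mrank M a)) => le.
  by exists M; rewrite -rcons_cons mem_rcons EY mem_head.
have [N [sN NS eN]] := H2 a; exists N; split=> //.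
by rewrite -rcons_cons mem_rcons inE NS orbT.
Qed.

(** * Irreducible classes *)

Lemma dominant_exists e : stable_edge G e -> exists N, dominant_with G e N.
Proof.
case/existsP=> M0 Me.
(* A matching through [e] of least total rank is dominant: its meet with any other such matching
   still contains [e], and would lower the total if some man gained. *)
pose total K := \sum_a mrank K a.
have [M /andP[sM eM] minM] :=
  @arg_minnP _ M0 (fun K => strongly_stable G K && (e \in K)) total Me.
exists M; rewrite /dominant_with sM eM /=; apply/forallP=> N.
apply/implyP=> /andP[sN eN]; apply/dominatesP => // a.
have sW := wedge_stable sM sN.
have eW : e \in wedge M N by rewrite inE; case: ifP.
have leW c : mrank (wedge M N) c <= mrank M c by rewrite mrank_wedge geq_minl.
have := minM (wedge M N); rewrite sW eW => /(_ isT) le.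
have leS : total (wedge M N) <= total M by apply: leq_sum => c _; apply: leW.
suff -> : mrank M a = mrank (wedge M N) a by rewrite mrank_wedge geq_minr.
apply/eqP; rewrite eqn_leq leW andbT leqNgt; apply/negP => lt.
have: total (wedge M N) < total M.
  rewrite /total (bigD1 a) // [X in _ < X](bigD1 a) //=.
  by rewrite -addSn leq_add // leq_sum.
by rewrite ltnNge le.
Qed.

Lemma edge_classP e : stable_edge G e ->
  exists2 N, dominant_with G e N & edge_class G e = ssm_class G N.
Proof.
move/dominant_exists=> [M dM]; rewrite /edge_class.
by case: pickP => [N dN|/(_ M)]; [exists N | rewrite dM].
Qed.

Lemma irreducible_rep T : T \in irreducibles G ->
  exists e, exists2 N, dominant_with G e N & T = ssm_class G N.
Proof. by case/imsetP => e /edge_classP[N dN EN] ->; exists e, N. Qed.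

Lemma irreducible_class T : T \in irreducibles G ->
  exists2 M, strongly_stable G M & T = ssm_class G M.
Proof. by case/irreducible_rep=> e [N /and3P[sN _ _]]; exists N. Qed.

(** The meet of [N] with [M] keeps [(a, b)], so [N] dominates this meet, which in turn dominates
    [M]. *)
Lemma dominant_dominates a b N M : dominant_with G (a, b) N ->
  strongly_stable G M -> mrank N a <= mrank M a ->
  forall c, mrank N c <= mrank M c.
Proof.
case/and3P=> sN abN /forallP dN sM le c.
have sW := wedge_stable sN sM.
have := dN (wedge N M); rewrite sW mem_wedge //= => /dominatesP.
by move=> /(_ sN sW c); rewrite mrank_wedge leq_min => /andP[].
Qed.

(** * Closed sets and the irreducibles above a class *)

Definition irreducible_dominators X : {set {set {set A * B}}} :=
  [set T in irreducibles G | class_dominates G T X].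

(** This makes [irreducible_dominators] a left inverse of [bigvee] on nonempty closed sets. *)
Lemma nonempty_closed_bigvee S : S \in nonempty_closed G ->
  S = irreducible_dominators (bigvee G S) /\
  exists2 K, strongly_stable G K & bigvee G S = ssm_class G K.
Proof.
rewrite inE => /andP[S0 /andP[/subsetP Sirr /'forall_in_forall_inP Sclosed]].
have [|K [sK EK ubK attK]] := bigvee_class S0.
  by move=> T /Sirr; apply: irreducible_class.
split; last by exists K.
apply/setP=> T; rewrite inE EK; apply/idP/andP => [TS|[Tirr]].
  have Tirr := Sirr _ TS; split=> //.
  case/irreducible_class: (Tirr) => M sM EM; rewrite EM in TS *.
  by apply/class_dominatesP => // a; apply: ubK.
case/irreducible_rep: (Tirr) => -[a b] [N dN EN].
have /and3P[sN _ _] := dN; rewrite {1}EN => /class_dominatesP H.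
(* A member of [S] in which [a] fares as in the join: [N] dominates it already because of this one
   man, and closedness applies. *)
have [M [sM MS EM]] := attK a.
apply: implyP (Sclosed _ MS _ Tirr) _; rewrite EN; apply/class_dominatesP => //.
by apply: (dominant_dominates dN) => //; rewrite EM; apply: H.
Qed.

(** Every edge blocks the empty matching. A pair of [M] is needed later to obtain at least one
    irreducible dominating [M]. *)
Lemma stable_matching_neq0 M :
  edges G != set0 -> strongly_stable G M -> M != set0.
Proof.
case/set0Pn=> -[a b] abE /strongly_stableP[mM sM]; apply/eqP=> M0.
have := sM _ abE; rewrite M0 in_set0 /rank_blocks => /(_ isT) /negP; apply.
have -> : mrank set0 a = size (mpref G a).
  by rewrite /mrank /mpartner; case: pickP => // c; rewrite in_set0.
have -> : wrank set0 b = size (wpref G b).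
  by rewrite /wrank /wpartner; case: pickP => // c; rewrite in_set0.
by rewrite mtie_lt // ltnW // wtie_lt.
Qed.

(** The witness represents the irreducible class of [(a, b)]: it dominates [M], which contains this
    edge, and it also marries [a] to [b]. *)
Lemma mem_irreducible_dominators M a b : strongly_stable G M -> (a, b) \in M ->
  exists N, [/\ strongly_stable G N, mrank N a = mrank M a
             & ssm_class G N \in irreducible_dominators (ssm_class G M)].
Proof.
move=> sM ab; have st : stable_edge G (a, b) by apply/existsP; exists M; rewrite sM.
have [N /and3P[sN abN /forallP/(_ M)]] := edge_classP st.
rewrite sM ab => /(dominatesP sN sM) NM EN; exists N; split=> //.
  have [[mM _] [mN _]] := (strongly_stableP _ sM, strongly_stableP _ sN).
  by rewrite (mrank_eq mM ab) (mrank_eq mN abN).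
rewrite inE; apply/andP; split; last exact/class_dominatesP.
by apply/imsetP; exists (a, b).
Qed.

Lemma irreducible_dominators_closed M :
  edges G != set0 -> strongly_stable G M ->
  irreducible_dominators (ssm_class G M) \in nonempty_closed G.
Proof.
move=> G0 sM; rewrite inE; apply/and3P; split.
- have /set0Pn[[a b] ab] := stable_matching_neq0 G0 sM.
  have [N [_ _ NS]] := mem_irreducible_dominators sM ab.
  by apply/set0Pn; exists (ssm_class G N).
- by apply/subsetP=> T; rewrite inE => /andP[].
apply/'forall_in_forall_inP=> T + T' Tirr'.
rewrite !inE Tirr' => /andP[/irreducible_class[N sN ->] NM].
have [N' sN' ->] := irreducible_class Tirr'.
apply/implyP => /(class_dominatesP sN' sN) N'N.
have {}NM := class_dominatesP sN sM NM.
by apply/class_dominatesP => // a; apply: leq_trans (N'N a) (NM a).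
Qed.

Lemma bigvee_irreducible_dominators M :
  edges G != set0 -> strongly_stable G M ->
  bigvee G (irreducible_dominators (ssm_class G M)) = ssm_class G M.
Proof.
move=> G0 sM; have := irreducible_dominators_closed G0 sM.
rewrite inE => /andP[S0 _].
have [|K [sK -> ubK attK]] := bigvee_class S0.
  by move=> T; rewrite inE => /andP[/irreducible_class].
apply/ssm_class_eq => // a; apply/eqP; rewrite eqn_leq; apply/andP; split.
  have [N [sN + <-]] := attK a.
  by rewrite inE => /andP[_ /(class_dominatesP sN sM)].
have [mK _] := strongly_stableP _ sK; have [mM _] := strongly_stableP _ sM.
have [/mrank_matched[b ab]|ge] := ltnP (mrank M a) (size (mpref G a)).
  have [N [sN <- NS]] := mem_irreducible_dominators sM ab.
  exact: ubK.
(* Here [a] is unmatched in [M]; a partner in [K] would give him one in [M]. *)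
rewrite (leq_trans (mrank_le mM a)) // leqNgt; apply/negP => lt.
by move: ge; rewrite leqNgt (matched_lt sK sM lt).
Qed.

Lemma ssm_classesP X :
  reflect (exists2 M, strongly_stable G M & X = ssm_class G M)
          (X \in ssm_classes G).
Proof.
have classE M : [set N in [set M | strongly_stable G M] | sim G M N] = ssm_class G M.
  by apply/setP=> N; rewrite !inE.
apply: (iffP imsetP) => -[M sM ->]; exists M => //; first by rewrite inE in sM.
by rewrite inE.
Qed.

End Ranks.

Theorem theorem5 (A B : finType) (G : ssm_instance A B)
    (edgesN0 : edges G != set0) :
  {in nonempty_closed G &, injective (bigvee G)} /\
  bigvee G @: nonempty_closed G = ssm_classes G.
Proof.
split=> [S S' /nonempty_closed_bigvee[ES _] /nonempty_closed_bigvee[ES' _] eqSS'|].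
  by rewrite ES ES' eqSS'.
apply/setP=> X; apply/imsetP/ssm_classesP => [[S SC ->]|[M sM ->]].
  by have [] := nonempty_closed_bigvee SC.
(* The preimage of a class consists of all irreducibles dominating it. *)
exists (irreducible_dominators G (ssm_class G M)).
  exact: irreducible_dominators_closed.
by rewrite bigvee_irreducible_dominators.
Qed.
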